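(* Let $(a_n)_{n\ge 1}$ be an arithmetic sequence and let $x\in\mathbb{T}$ have canonical representation $x=\sum_{n=1}^\infty\frac{c_n}{a_n}$ with respect to $(a_n)$. Suppose that the sequence of ratios $(q_n)$ has the $d$-splitting property, witnessed by the partition $\mathbb{N}=B\cup D$. Then $x$ is a topological $s$-torsion element, i.e. $x\in t^s_{(a_n)}(\mathbb{T})$ (meaning $a_nx\to0$ statistically in $\mathbb{T}$), if and only if the following conditions hold: (i) $B^S(x)+1\subseteq^d \mathrm{supp}(x)$, $B^S(x)\subseteq^d \mathrm{supp}_q(x)$, and if $\overline{d}(B^S(x))>0$ then $\lim_{n\in B_1^S(x)}\frac{c_{n+1}+1}{q_{n+1}}=1$ in $\mathbb{R}$ for some $B_1\subseteq B$ with $d(B\setminus B_1)=0$. (ii) If $\overline{d}(B^N(x))>0$, then $\lim_{n\in B_1^N(x)}\frac{c_{n+1}}{q_{n+1}}=0$ in $\mathbb{R}$ for some $B_1\subseteq B$ with $d(B\setminus B_1)=0$. (iii) If $\overline{d}(D^S(x))>0$, then $\lim_{n\in D_1^S(x)}\frac{c_n}{q_n}=0$ in $\mathbb{T}$ for some $D_1\subseteq D$ with $d(D\setminus D_1)=0$.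
   Context: $\mathbb{N}=\{1,2,3,\dots\}$; $\mathbb{T}=\mathbb{R}/\mathbb{Z}$ with its usual compact topology. A limit of real numbers ''$=0$ in $\mathbb{T}$'' means convergence to $0$ of their classes modulo $\mathbb{Z}$ (i.e. the distance to the nearest integer tends to $0$), as opposed to convergence in $\mathbb{R}$. For infinite $A\subseteq\mathbb{N}$, $\lim_{n\in A}$ denotes the limit as $n\to\infty$ with $n\in A$. Density: for $A\subseteq\mathbb{N}$, $\overline{d}(A)=\limsup_{n\to\infty}\frac{|A\cap[0,n-1]|}{n}$ and $\underline{d}(A)=\liminf_{n\to\infty}\frac{|A\cap[0,n-1]|}{n}$; if they agree the common value is the natural density $d(A)$. Write $A\subseteq^d B$ if $d(A\setminus B)=0$. Also $A+1=\{n+1: n\in A\}$. Arithmetic sequence: a sequence of positive integers with $1<a_1<a_2<\cdots$ and $a_n\mid a_{n+1}$ for every $n\in\mathbb{N}$. Put $a_0=1$ and $q_n=a_n/a_{n-1}$ for $n\ge1$. A set $A\subseteq\mathbb{N}$ is $q$-bounded if $(q_n)_{n\in A}$ is bounded, and an infinite $A$ is $q$-divergent if $\lim_{n\in A}q_n=\infty$. Canonical representation: every $x\in\mathbb{T}$ has a unique representation $x=\sum_{n=1}^\infty\frac{c_n}{a_n}$ (modulo $1$) with integers $0\le c_n<q_n$ and $c_n<q_n-1$ for infinitely many $n$. Put $\mathrm{supp}(x)=\{n\in\mathbb{N}: c_n\ne0\}$ and $\mathrm{supp}_q(x)=\{n\in\mathbb{N}: c_n=q_n-1\}$. $a_nx\to0$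 statistically in $\mathbb{T}$ means: for every neighbourhood $U$ of $0$ in $\mathbb{T}$, $d(\{n\in\mathbb{N}: a_nx\notin U\})=0$. $t^s_{(a_n)}(\mathbb{T})$ is the set of all such $x\in\mathbb{T}$; its elements are the topological $s$-torsion elements. $d$-splitting property: a sequence $(q_n)$ of natural numbers has the $d$-splitting property if there is a partition $\mathbb{N}=B\cup D$ (into disjoint, possibly empty sets; $B,D$ are then said to witness the property) such that: each of $B$ and $D$ is either empty or of positive upper density; if $\overline{d}(B)>0$, there is $B'\subseteq\mathbb{N}$ with $d(B\triangle B')=0$ such that $B'$ is $q$-bounded; if $\overline{d}(D)>0$, there is $D'\subseteq\mathbb{N}$ with $d(D\triangle D')=0$ such that $D'$ is $q$-divergent. For any set $E\subseteq\mathbb{N}$ (in particular $E=B,B_1,D,D_1$), $E^S(x)=E\cap\mathrm{supp}(x)$ and $E^N(x)=E\cap(\mathbb{N}\setminus\mathrm{supp}(x))$. *)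

(* Defs.v *)
From HB Require Import structures.
From mathcomp Require Import all_boot all_order all_algebra.
From mathcomp Require Import generic_quotient ring_quotient.
From mathcomp Require Import all_classical all_reals all_analysis.

Set Implicit Arguments.
Unset Strict Implicit.
Unset Printing Implicit Defensive.

Import Order.TTheory GRing.Theory Num.Theory.
Import numFieldNormedType.Exports.

Local Open Scope classical_set_scope.
Local Open Scope ring_scope.
Local Open Scope quotient_scope.

(* [int_num_subdef] is the predicate underlying [Num.int]; the instance making
   it a subgroup of R is attached to it. *)
Definition int_subgroup (R : realType) : zmodClosed R :=
  GRing.ZmodClosed.clone R (@Num.int_num_subdef R) _.

Definition torus (R : realType) : Type :=
  quotient_topology (Quotient.clone R (Quotient.quot (int_subgroup R)) _).
HB.instance Definition _ (R : realType) := Topological.on (torus R).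
(* The group structure is rebuilt rather than copied, so that it shares the
   decidable equality of the topological structure. *)
HB.instance Definition _ (R : realType) :=
  GRing.isZmodule.Build (torus R)
    (@Quotient.addqA R (int_subgroup R)) (@Quotient.addqC R (int_subgroup R))
    (@Quotient.add0q R (int_subgroup R)) (@Quotient.addNq R (int_subgroup R)).

Definition to_torus (R : realType) (y : R) : torus R := \pi_(torus R) y.

Lemma to_torusD (R : realType) (y z : R) :
  to_torus (y + z) = to_torus y + to_torus z.
Proof. exact: Quotient.pi_add. Qed.

Lemma to_torus0 (R : realType) : to_torus (0 : R) = 0.
Proof. by apply: (addIr (to_torus (0 : R))); rewrite -to_torusD !add0r. Qed.

Lemma to_torus_eq (R : realType) (y z : R) :
  to_torus y = to_torus z <-> y - z \is a Num.int.
Proof.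
have h := Quotient.idealrBE (int_subgroup R) y z.
split=> [e|].
  by change (y - z \in int_subgroup R); rewrite h; apply/eqP.
by change (y - z \in int_subgroup R -> to_torus y = to_torus z); rewrite h => /eqP.
Qed.

Lemma open_torusE (R : realType) (U : set (torus R)) :
  open U = open (@to_torus R @^-1` U).
Proof. by []. Qed.

Definition pos_nats : set nat := [set n | (0 < n)%N].

Section Density.
Variable R : realType.
Implicit Types A B : set nat.

Definition counting_ratio A : R^nat :=
  fun n => #|[pred k : 'I_n | (k : nat) \in A]|%:R / n%:R.

Definition upper_density A : R := limn_sup (counting_ratio A).
Definition lower_density A : R := limn_inf (counting_ratio A).

Definition has_density A (r : R) : Prop :=
  upper_density A = r /\ lower_density A = r.

Definition almost_subset A B : Prop := has_density (A `\` B) 0.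
End Density.

Definition succ_set (A : set nat) : set nat := [set n.+1 | n in A].

(* The value at index 0 is the convention a_0 = 1. *)
Definition arithmetic_seq (a : nat -> nat) : Prop :=
  [/\ a 0%N = 1%N, (1 < a 1%N)%N,
      forall n, (0 < n)%N -> (a n < a n.+1)%N &
      forall n, (0 < n)%N -> (a n %| a n.+1)%N].

Definition quot_seq (a : nat -> nat) (n : nat) : nat := (a n %/ a n.-1)%N.

Definition q_bounded (q : nat -> nat) (A : set nat) : Prop :=
  exists M : nat, forall n, A n -> (q n <= M)%N.

Definition q_divergent (q : nat -> nat) (A : set nat) : Prop :=
  infinite_set A /\ q n @[n --> within A \oo] --> \oo.

Definition d_splitting_witness (R : realType) (q : nat -> nat)
    (B D : set nat) : Prop :=
  [/\ B `|` D = pos_nats, B `&` D = set0,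
      (B = set0 \/ 0 < upper_density R B) /\
      (D = set0 \/ 0 < upper_density R D),
      0 < upper_density R B -> exists B' : set nat,
        [/\ B' `<=` pos_nats, has_density (B `+` B') (0 : R) & q_bounded q B'] &
      0 < upper_density R D -> exists D' : set nat,
        [/\ D' `<=` pos_nats, has_density (D `+` D') (0 : R) & q_divergent q D']].

Section Canonical.
Variables (R : realType) (a : nat -> nat).
Local Notation q := (quot_seq a).

(* c 0 is irrelevant.  The series has nonnegative terms and, under the first
   condition, partial sums at most 1, so the limit is not a junk value. *)
Definition canonical_repr (x : torus R) (c : nat -> nat) : Prop :=
  [/\ forall n, (0 < n)%N -> (c n < q n)%N,
      infinite_set [set n | (0 < n)%N /\ (c n < q n - 1)%N] &
      x = to_torus
            (limn (fun n => \sum_(1 <= k < n) (c k)%:R / (a k)%:R : R))].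

Definition supp (c : nat -> nat) : set nat :=
  [set n | (0 < n)%N /\ c n <> 0%N].

Definition supp_q (c : nat -> nat) : set nat :=
  [set n | (0 < n)%N /\ c n = (q n - 1)%N].

Definition stat_cvg0 (u : nat -> torus R) : Prop :=
  forall U : set (torus R), nbhs (0 : torus R) U ->
    has_density [set n | (0 < n)%N /\ ~ U (u n)] (0 : R).

Definition s_torsion : set (torus R) :=
  [set x | stat_cvg0 (fun n => x *+ a n)].
End Canonical.

Definition suppS (c : nat -> nat) (E : set nat) : set nat := E `&` supp c.
Definition suppN (c : nat -> nat) (E : set nat) : set nat :=
  E `&` (pos_nats `\` supp c).

(* Main.v *)
Require Import Defs.
From mathcomp Require Import all_boot all_order all_algebra.
From mathcomp Require Import all_classical all_reals all_analysis.
From mathcomp Require Import zify ring lra.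
Import Order.TTheory GRing.Theory Num.Theory.
Import numFieldNormedType.Exports.
Local Open Scope classical_set_scope.
Local Open Scope ring_scope.

(* Put r_n = a_n (S - S_n), where S is the real sum of the canonical series and
   S_n its partial sum up to n.  Then r_n lies in [0, 1], represents a_n x
   modulo 1, and satisfies q_{n+1} r_n = c_{n+1} + r_{n+1}.  All conditions are
   limits along the filter of sets of density one, because density zero is a
   P-ideal.  Up to null sets, r_{n-1} and c_n / q_n have the same limits where q_n
   is unbounded; where q_n is bounded and r_{n-1} is near an integer, the
   recursion leaves only c_n = 0 with r_n near 0 and c_n = q_n - 1 with r_n near
   1.  Conversely, the substitution
   r -> 1 - r, c -> q - 1 - c exchanges the cases c_n = q_n - 1 and c_n = 0, and
   in the latter case the recursion contracts r by a factor 2 at each bounded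
   step. *)

(** * Sets of density zero, in integer arithmetic *)

Definition cnt (A : set nat) (n : nat) : nat :=
  #|[pred k : 'I_n | (k : nat) \in A]|.

(** Density zero with the division cleared: the ratio is eventually at most [1/K] for each positive
    [K]. Closure properties then become counting. *)
Definition null (A : set nat) : Prop :=
  forall K : nat, \forall n \near \oo, (cnt A n * K <= n)%N.

Lemma cntE A n : cnt A n = (\sum_(k < n) ((k : nat) \in A))%N.
Proof.
rewrite /cnt -sum1_card big_mkcond; apply: eq_bigr => k _.
by rewrite inE /=; case: (_ \in A).
Qed.

Lemma cntS A n : cnt A n.+1 = (cnt A n + (n \in A))%N.
Proof. by rewrite !cntE big_ord_recr. Qed.

Lemma cnt_shift A n : cnt A n.+1 = ((0%N \in A) + cnt [set k | A k.+1] n)%N.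
Proof. by rewrite !cntE big_ord_recl. Qed.

Lemma le_cnt A A' n : (forall k, (k < n)%N -> A k -> A' k) -> (cnt A n <= cnt A' n)%N.
Proof.
move=> AA'; apply/subset_leq_card/fintype.subsetP => k; rewrite !inE => Ak.
exact: AA'.
Qed.

Lemma cntU A A' n : (cnt (A `|` A') n <= cnt A n + cnt A' n)%N.
Proof.
rewrite !cntE -big_split; apply: leq_sum => k _; rewrite /= in_setU.
by case: (_ \in A) => //=; case: (_ \in A').
Qed.

Lemma sub_null A A' : A `<=` A' -> null A' -> null A.
Proof.
move=> AA' A'0 K; apply: filterS (A'0 K) => n; apply: leq_trans.
by rewrite leq_mul2r le_cnt ?orbT// => k _; apply: AA'.
Qed.

Lemma nullU A A' : null A -> null A' -> null (A `|` A').
Proof.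
move=> A0 A'0 K; apply: filterS2 (A0 (2 * K)%N) (A'0 (2 * K)%N) => n.
have := cntU A A' n; nia.
Qed.

Lemma null_shift A : null [set k | A k.+1] <-> null A.
Proof.
split=> A0 K; have := A0 (2 * K)%N.
  move=> h; near=> n.
  have h1 : (2 * K + 1 <= n)%N by near: n; exact: nbhs_infty_ge.
  have h2 : (cnt [set k | A k.+1] n * (2 * K) <= n)%N by near: n.
  have := cnt_shift A n; have := cntS A n; lia.
case=> N _ h; exists N.+1 => // n /= Nn.
have : (cnt A n.+1 * (2 * K) <= n.+1)%N by apply: h => /=; lia.
rewrite cnt_shift; nia.
Unshelve. all: by end_near. Qed.

Lemma null_set0 : null set0.
Proof.
move=> K; apply: nearW => n; rewrite (_ : cnt _ _ = 0%N)//.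
by rewrite cntE big1// => k _; rewrite in_set0.
Qed.

(** * The filter of sets of density one *)

Definition stat : set_system nat := [set A | null (~` A)].

Global Instance stat_filter : Filter stat.
Proof.
split=> [|P Q|P Q PQ].
- by rewrite /stat/= setCT; exact: null_set0.
- by rewrite /stat/= setCI; exact: nullU.
- by apply: sub_null => n; apply: contra_not; apply: PQ.
Qed.

(** A shift by one changes the counts by at most one. It is needed because the recursion ties [r n]
    to the digit at [n.+1]. *)
Lemma stat_shift (P : set nat) : (\forall n \near stat, P n.+1) <-> \forall n \near stat, P n.
Proof. exact: null_shift. Qed.

Lemma stat_le_eventually (P : set nat) : (\forall n \near \oo, P n) -> \forall n \near stat, P n.
Proof.
case=> N _; elim: N P => [|N IH] P h.
  by apply: nearW => n; apply: h.
by apply/stat_shift/IH => n Nn; apply: h.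
Qed.

Lemma null_near (P : set nat) : null P <-> \forall n \near stat, ~ P n.
Proof. by rewrite -[P in null P]setCK. Qed.

(* [Z] collects, for each [k], the points of the complement of [P k] beyond the
   place where the density of that complement stays below [1/k]. *)
Lemma stat_pseudo_intersection (P : nat -> set nat) :
  (forall k l, (k <= l)%N -> P l `<=` P k) ->
  (forall k, \forall n \near stat, P k n) ->
  exists Z, null Z /\ forall k, \forall n \near \oo, ~ Z n -> P k n.
Proof.
move=> Pmono Pstat.
pose small k n := forall j, (n < j)%N -> (cnt (~` P k) j * k <= j)%N.
pose Z := [set n | exists2 k, ~ P k n & small k n].
exists Z; split; last first.
  move=> k; have [N _ h] := Pstat k k; exists N => // n Nn nZ.
  apply: contra_notP nZ => nP; exists k => // j nj; apply: h => /=.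
  exact: leq_trans Nn (ltnW nj).
(* Below [n], all of [Z] lies outside a single [P k], where [k] is either the prescribed [K] or an
   index whose density bound already holds from [n] on. *)
have sub K n : exists k, [/\ (K <= k)%N,
    (forall i, (i < n)%N -> Z i -> ~ P k i) &
    k = K \/ forall j, (n <= j)%N -> (cnt (~` P k) j * k <= j)%N].
  elim: n => [|n [k [Kk sub kn]]].
    by exists K; split=> //; left.
  have mono l : (k <= l)%N -> forall i, (i < n)%N -> Z i -> ~ P l i.
    move=> kl i ni Zi; have := sub i ni Zi; apply: contra_not; exact: Pmono.
  have [[l nP ls]|nZ] := pselect (Z n); last first.
    exists k; split=> //; last by case: kn; [left|right=> j /ltnW; auto].
    move=> i; rewrite ltnS leq_eqVlt => /predU1P[->|ni] //.
    exact: sub.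
  have [kl|lk] := leqP k l.
    exists l; split; [exact: leq_trans kl| |by right].
    move=> i; rewrite ltnS leq_eqVlt => /predU1P[->|ni] //.
    exact: mono.
  (* The larger index is kept: [P k] is contained in [P l], so a point outside [P l] is outside
     [P k]. *)
  exists k; split=> //; last by case: kn; [left|right=> j /ltnW; auto].
  move=> i; rewrite ltnS leq_eqVlt => /predU1P[->|ni]; last exact: sub.
  by move=> _; apply: contra_not nP; apply: Pmono; exact: ltnW.
move=> K; apply: filterS (Pstat K K) => n Kn.
have [k [Kk sub' kn]] := sub K n.
have le : (cnt Z n <= cnt (~` P k) n)%N by apply: le_cnt.
case: kn => [kK|h]; first by rewrite kK in le; nia.
have := h n (leqnn n); nia.
Qed.

(** * Comparison with real-valued densities and with limits along subsets *)

Section Density.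
Context {R : realType}.
Implicit Types A : set nat.

Lemma counting_ratio_ge0 A n : 0 <= counting_ratio R A n.
Proof. exact: divr_ge0. Qed.

Lemma counting_ratio_le1 A n : counting_ratio R A n <= 1.
Proof.
rewrite /counting_ratio; case: n => [|n]; first by rewrite invr0 mulr0.
by rewrite ler_pdivrMr// mul1r ler_nat -[X in (_ <= X)%N]card_ord max_card.
Qed.

Lemma counting_ratio_bounded A : bounded_fun (counting_ratio R A).
Proof.
exists 1; split=> // M M1 n _; rewrite /= ger0_norm ?counting_ratio_ge0//.
exact: le_trans (counting_ratio_le1 _ _) (ltW M1).
Qed.

Lemma null_cvg A : null A -> counting_ratio R A n @[n --> \oo] --> (0 : R).
Proof.
move=> A0; apply/cvgrPdist_le => e e0; near=> n.
have n0 : (0 < n)%N by near: n; exact: nbhs_infty_gt.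
pose K := Num.bound e^-1.
have Ke : 1 <= K%:R * e.
  by rewrite -ler_pdivrMr// mul1r ltW// archi_boundP// invr_ge0 ltW.
rewrite sub0r normrN ger0_norm ?counting_ratio_ge0//.
rewrite /counting_ratio -/(cnt A n) ler_pdivrMr ?ltr0n//.
have : (cnt A n * K <= n)%N by near: n; exact: A0.
rewrite -(ler_nat R) natrM => h.
have : 0 <= (cnt A n)%:R :> R by [].
nra.
Unshelve. all: by end_near. Qed.

Lemma null_density A : null A -> has_density A (0 : R).
Proof. by move=> /null_cvg/cvg_limn_inf_sup[]. Qed.

Lemma upper_density_le0 A : upper_density R A <= 0 -> null A.
Proof.
move=> ud K.
have bnd := counting_ratio_bounded A.
(* The suprema of the tails converge to the upper density and dominate the ratios, so the ratios
   fall below [1/(K+1)]. *)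
have cv : sups (counting_ratio R A) @ \oo --> upper_density R A.
  rewrite /upper_density limn_supE//; apply: cvg_sups_inf.
    exact: bounded_fun_has_ubound.
  exact: bounded_fun_has_lbound.
have e0 : 0 < K.+1%:R^-1 :> R by rewrite invr_gt0.
near=> n.
have n0 : (0 < n)%N by near: n; exact: nbhs_infty_gt.
have : sups (counting_ratio R A) n < K.+1%:R^-1.
  near: n; apply: (cvgr_lt _ cv); exact: le_lt_trans ud e0.
have : counting_ratio R A n <= sups (counting_ratio R A) n.
  apply: ub_le_sup; last by exists n => /=.
  exact/has_ubound_sdrop/bounded_fun_has_ubound.
move=> h1 h2; have := le_lt_trans h1 h2.
rewrite /counting_ratio -/(cnt A n) ltr_pdivrMr ?ltr0n// mulrC ltr_pdivlMr//.
by rewrite -natrM ltr_nat; nia.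
Unshelve. all: by end_near. Qed.

Lemma has_density0 A : has_density A (0 : R) <-> null A.
Proof.
split; last exact: null_density.
by case=> h _; apply: upper_density_le0; rewrite h.
Qed.

(** The target filter has a countable decreasing base [V], so the exceptional null sets, one for
    each [V k], are absorbed by a single null [Z], and [E1] is [E] without [Z]. If [E] meets [S] in
    a null set, the limit along [stat] is vacuous, which accounts for the premise on the upper
    density. *)
Lemma stat_cvgP (T : Type) (G : set_system T) (V : nat -> set T) (E S : set nat) (f : nat -> T) :
  (forall k l, (k <= l)%N -> V l `<=` V k) -> (forall k, G (V k)) ->
  (forall U, G U -> exists k, V k `<=` U) ->
  (0 < upper_density R (E `&` S) ->
   exists E1, [/\ E1 `<=` E, has_density (E `\` E1) (0 : R) &
     f n @[n --> within (E1 `&` S) \oo] --> G]) <->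
  f n @[n --> within (E `&` S) stat] --> G.
Proof.
move=> Vmono GV Vbase; split=> [h|h _].
  have [/h[E1 [E1E /has_density0 EE1 fG]]|/upper_density_le0/null_near ES0] :=
    ltP 0 (upper_density R (E `&` S)); last first.
    by move=> U _; apply: filterS ES0 => n nES /nES.
  move=> U /fG; rewrite /= /within /= => /stat_le_eventually hU.
  change (\forall n \near stat, (E `&` S) n -> U (f n)).
  move: EE1; rewrite null_near => EE1.
  apply: filterS2 EE1 hU => n nEE1 h1 [En Sn]; apply: h1; split=> //.
  by apply: contrapT => nE1; apply: nEE1.
have [k l kl n|k|Z [Z0 hZ]] :=
    @stat_pseudo_intersection (fun k => [set n | (E `&` S) n -> V k (f n)]).
- by move=> /= hV ES; apply: (Vmono k l) => //; exact: hV.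
- exact: h (GV k).
exists (E `\` Z); split; first by move=> n [].
  by rewrite has_density0; apply: sub_null Z0 => n [En]; apply: contra_notP => nZ; split.
move=> U /Vbase[k VU]; rewrite /= /within /=.
by apply: filterS (hZ k) => n hn [[En nZ] Sn]; apply: VU; exact: hn.
Qed.

End Density.

(** * Convergence to zero in the torus, read on real representatives *)

Section Torus.
Context {R : realType}.

Lemma nbhs_torus0 (U : set (torus R)) :
  nbhs (0 : torus R) U <->
  exists2 e : R, 0 < e & @to_torus R @` [set y : R | `|y| < e] `<=` U.
Proof.
split.
  rewrite nbhsE => -[V [oV V0] VU].
  have : nbhs (0 : R) (@to_torus R @^-1` V).
    by apply: open_nbhs_nbhs; split; [rewrite -open_torusE|rewrite /= to_torus0].
  case/nbhs_ballP => e /= e0 eV; exists e => // _ [y ye <-].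
  by apply/VU/eV; rewrite /ball/= sub0r normrN.
case=> e e0 eU; rewrite nbhsE; exists (@to_torus R @` [set y : R | `|y| < e]) => //.
split; last by exists 0 => /=; [rewrite normr0|rewrite to_torus0].
rewrite open_torusE openE => z [y ye] /esym/to_torus_eq zy.
apply/nbhs_ballP; exists (e - `|y|) => /= [|w]; first by rewrite subr_gt0.
(* The image of the interval is open: the representative [y] of [z] is moved by the same
   displacement [w - z], which is too short to leave the interval. *)
rewrite /ball/= => zw; exists (y + (w - z)) => /=.
  by rewrite (le_lt_trans (ler_normD _ _))// [`|w - z|]distrC -ltrBrDl.
by apply/to_torus_eq; rewrite (_ : _ - w = - (z - y)) ?rpredN//; lra.
Qed.

Lemma torus_cvg0 (F : set_system nat) (FF : Filter F) (u : nat -> R) :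
  (\forall n \near F, 0 <= u n <= 1) ->
  to_torus (u n) @[n --> F] --> (0 : torus R) <->
  forall e : R, 0 < e -> \forall n \near F, u n < e \/ 1 - e < u n.
Proof.
move=> u01; split=> [h e e0|h U /nbhs_torus0[e e0 eU]].
  have uV : \forall n \near F, (@to_torus R @` [set y : R | `|y| < e]) (to_torus (u n)).
    by apply: h; apply/nbhs_torus0; exists e.
  apply: filterS2 u01 uV => n /andP[u0 u1] [y /= ye /esym/to_torus_eq/intrP[m um]].
  move: ye; rewrite ltr_norml => /andP[ye1 ye2].
  (* Here [u n = y + m] with [y] small: [m <= 0] puts [u n] below [e], and [m >= 1] puts it above
     [1 - e]. *)
  have [m0|m1] := lerP m 0; [left|right].
    have : m%:~R <= 0 :> R by rewrite lerz0.
    lra.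
  have : 1 <= m%:~R :> R by rewrite ler1z.
  lra.
apply: filterS2 u01 (h e e0) => n /andP[u0 u1] [ue|ue]; apply: eU.
  by exists (u n) => //=; rewrite ger0_norm.
exists (u n - 1); first by rewrite /= ltr_norml; apply/andP; split; lra.
by apply/to_torus_eq; rewrite addrAC subrr add0r rpredN int_num1.
Qed.

Lemma stat_cvg_realP (l : R) (E S : set nat) (f : nat -> R) :
  (0 < upper_density R (E `&` S) ->
   exists E1, [/\ E1 `<=` E, has_density (E `\` E1) (0 : R) &
     f n @[n --> within (E1 `&` S) \oo] --> l]) <->
  forall e : R, 0 < e -> \forall n \near stat, E n -> S n -> `|l - f n| < e.
Proof.
apply: (iff_trans (@stat_cvgP _ _ (nbhs l) (fun k => ball l k.+1%:R^-1) _ _ _ _ _ _)).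
- move=> k m km; apply: le_ball; rewrite lef_pV2 ?posrE ?ltr0n//.
  by rewrite ler_nat.
- by move=> k; apply: nbhsx_ballx; rewrite invr_gt0.
- move=> U /nbhs_ballP[e /= e0 eU].
  have [k _ /(_ k (leqnn k)) /= ke] := near_infty_natSinv_lt (PosNum e0).
  exists k; apply: subset_trans eU; apply: le_ball; exact: ltW.
split=> [/cvgrPdist_lt h e e0|h].
  by apply: (@filterS _ stat _ _ _ _ (h e e0)) => n hn En Sn; apply: hn.
by apply/cvgrPdist_lt => e e0; apply: (@filterS _ stat _ _ _ _ (h e e0)) => n hn [En Sn]; apply: hn.
Qed.

Lemma stat_cvg_torusP (E S : set nat) (u : nat -> R) :
  (forall n, S n -> 0 <= u n <= 1) ->
  (0 < upper_density R (E `&` S) ->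
   exists E1, [/\ E1 `<=` E, has_density (E `\` E1) (0 : R) &
     to_torus (u n) @[n --> within (E1 `&` S) \oo] --> (0 : torus R)]) <->
  forall e : R, 0 < e -> \forall n \near stat, E n -> S n -> u n < e \/ 1 - e < u n.
Proof.
move=> u01.
pose V k := @to_torus R @` [set y : R | `|y| < k.+1%:R^-1].
apply: (iff_trans (@stat_cvgP _ _ (nbhs (0 : torus R)) V _ _ _ _ _ _)).
- move=> k m km _ [y /= ym <-]; exists y => //=; apply: lt_le_trans ym _.
  by rewrite lef_pV2 ?posrE ?ltr0n// ler_nat.
- by move=> k; apply/nbhs_torus0; exists k.+1%:R^-1 => //; rewrite invr_gt0.
- move=> U /nbhs_torus0[e /= e0 eU].
  have [k _ /(_ k (leqnn k)) /= ke] := near_infty_natSinv_lt (PosNum e0).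
  exists k; apply: subset_trans eU => _ [y /= yk <-]; exists y => //=.
  exact: lt_trans yk ke.
apply: (iff_trans (torus_cvg0 _ _ _ _)).
  by apply: (@nearW _ stat) => n -[_ Sn]; exact: u01.
split=> h e e0; apply: (@filterS _ stat _ _ _ _ (h e e0)) => n hn.
  by move=> En Sn; apply: hn.
by case; apply: hn.
Qed.

End Torus.

(** * The scaled remainders of the canonical series *)

Section Remainder.
Context {R : realType} (a c : nat -> nat).
Hypothesis ha : arithmetic_seq a.
Hypothesis cq : forall n, (0 < n)%N -> (c n < quot_seq a n)%N.
Local Notation q := (quot_seq a).

Lemma arithmetic_seq_dvd n : (a n %| a n.+1)%N.
Proof. by case: ha => a0 _ _ h; case: n => [|n]; [rewrite a0 dvd1n|apply: h]. Qed.

Lemma arithmetic_seq_gt0 n : (0 < a n)%N.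
Proof.
case: ha => a0 a1 lt _; elim: n => [|n IH]; first by rewrite a0.
case: n IH => [|n] IH; first exact: ltnW.
by apply: ltn_trans IH _; apply: lt.
Qed.

Lemma arithmetic_seqS n : a n.+1 = (q n.+1 * a n)%N.
Proof. by rewrite /quot_seq /= divnK// arithmetic_seq_dvd. Qed.

Lemma quot_seq_gt1 n : (1 < q n.+1)%N.
Proof.
have := arithmetic_seqS n; have := arithmetic_seq_gt0 n; case: ha => a0 a1 lt _.
have : (a n < a n.+1)%N by case: n => [|n]; [rewrite a0|apply: lt].
nia.
Qed.

Definition psum (n : nat) : R := \sum_(1 <= k < n) (c k)%:R / (a k)%:R.

Definition remainder (n : nat) : R := (a n)%:R * (limn psum - psum n.+1).

Lemma psumS n : psum n.+2 = psum n.+1 + (c n.+1)%:R / (a n.+1)%:R.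
Proof. by rewrite /psum big_nat_recr. Qed.

Lemma psum_nondecreasing : nondecreasing_seq psum.
Proof.
apply/nondecreasing_seqP => -[|n]; first by rewrite /psum !big_geq.
by rewrite psumS lerDl divr_ge0.
Qed.

(** One step amounts to [c + 1 <= q] at [m.+1], divided by [a m.+1]. The inequality bounds the
    partial sums and yields [remainder n <= 1] in the limit. *)
Lemma psum_tail n m : (n <= m)%N -> psum m.+1 + (a m)%:R^-1 <= psum n.+1 + (a n)%:R^-1.
Proof.
elim: m => [|m IH]; first by rewrite leqn0 => /eqP ->.
rewrite leq_eqVlt => /predU1P[->//|nm]; apply: le_trans (IH nm).
rewrite psumS -addrA lerD2l -[X in _ + X]mul1r -mulrDl.
have am : 0 < (a m)%:R :> R by rewrite ltr0n arithmetic_seq_gt0.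
have qm : 0 < (q m.+1)%:R :> R by rewrite ltr0n ltnW ?quot_seq_gt1.
rewrite arithmetic_seqS natrM invfM mulrA -[X in _ <= X]mul1r ler_pM2r ?invr_gt0//.
by rewrite ler_pdivrMr// mul1r natr1 ler_nat cq.
Qed.

Lemma psum_cvg : cvgn psum.
Proof.
apply: nondecreasing_is_cvgn psum_nondecreasing _.
exists (psum 1 + (a 0)%:R^-1) => _ [n _ <-].
apply: le_trans (psum_tail _ _ (leq0n n)).
by rewrite (le_trans (psum_nondecreasing _ _ (leqnSn n)))// lerDl invr_ge0.
Qed.

Lemma remainder_itv n : 0 <= remainder n <= 1.
Proof.
have an : 0 < (a n)%:R :> R by rewrite ltr0n arithmetic_seq_gt0.
have le_lim : psum n.+1 <= limn psum.
  exact: nondecreasing_cvgn_le psum_nondecreasing psum_cvg _.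
rewrite /remainder mulr_ge0 ?(ltW an) ?subr_ge0//=.
rewrite mulrC -ler_pdivlMr// mul1r lerBlDl.
apply: limr_le; first exact: psum_cvg.
near=> m; have nm : (n < m)%N by near: m; exact: nbhs_infty_gt.
rewrite -(ltn_predK nm).
have nm' : (n <= m.-1)%N by rewrite -ltnS (ltn_predK nm).
by apply: le_trans (psum_tail _ _ nm'); rewrite lerDl invr_ge0.
Unshelve. all: by end_near. Qed.

Lemma remainderS n : (q n.+1)%:R * remainder n = (c n.+1)%:R + remainder n.+1.
Proof.
have an : (a n.+1)%:R != 0 :> R by rewrite pnatr_eq0 -lt0n arithmetic_seq_gt0.
rewrite /remainder psumS mulrA -natrM -arithmetic_seqS; field; exact: an.
Qed.

(** Every denominator [a k] with [k <= n] divides [a n]; hence the remainder and [a n] times the sum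
    agree modulo the integers. *)
Lemma a_psum_int n : (a n)%:R * psum n.+1 \is a Num.int.
Proof.
elim: n => [|n IH]; first by rewrite /psum big_geq ?mulr0.
have an : (a n.+1)%:R != 0 :> R by rewrite pnatr_eq0 -lt0n arithmetic_seq_gt0.
rewrite psumS mulrDr {1}arithmetic_seqS natrM -mulrA [_ * (_ / _)]mulrC divfK//.
have qS : (q n.+1)%:R * ((a n)%:R * psum n.+1) \is a Num.int by rewrite rpredM // natr_int.
by rewrite rpredD // natr_int.
Qed.

Lemma to_torus_mulrn (y : R) n : to_torus y *+ n = to_torus (y *+ n).
Proof.
elim: n => [|n IH]; first by rewrite !mulr0n to_torus0.
by rewrite !mulrS IH to_torusD.
Qed.

Lemma to_torus_remainder n : to_torus (limn psum) *+ a n = to_torus (remainder n).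
Proof.
rewrite to_torus_mulrn; apply/to_torus_eq.
rewrite /remainder mulrBr -[limn psum *+ _]mulr_natl opprB addrCA subrr addr0; exact: a_psum_int.
Qed.

End Remainder.

(** * The recursion linking remainders and digits *)

Section Dynamics.
Context {R : realType} (q c : nat -> nat) (r : nat -> R).
Hypothesis q_gt1 : forall n, (1 < q n.+1)%N.
Hypothesis cq : forall n, (c n.+1 < q n.+1)%N.
Hypothesis r01 : forall n, 0 <= r n <= 1.
Hypothesis rS : forall n, (q n.+1)%:R * r n = (c n.+1)%:R + r n.+1.

Section Forward.
Variables (B : set nat) (M : nat).
Hypothesis qB : \forall n \near stat, B n -> (q n <= M)%N.
Hypothesis rt : forall e : R, 0 < e -> \forall n \near stat, r n < e \/ 1 - e < r n.

Lemma digit_bounded_supp (e : R) : 0 < e ->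
  \forall n \near stat, B n -> c n <> 0%N -> c n = (q n - 1)%N /\ 1 - e < r n.
Proof.
(* An error [d / M.+1] in the remainder becomes at most [d] after multiplication by [q <= M]. As
   [d <= 1/2], a remainder near 0 excludes a nonzero digit, and one near 1 leaves only the digit
   [q - 1]. *)
move=> e0; pose d := Num.min e 2^-1.
have d0 : 0 < d by rewrite lt_min e0 invr_gt0 ltr0n.
have de : d <= e by rewrite ge_min lexx.
have d2 : d <= 2^-1 by rewrite ge_min lexx orbT.
have M0 : 0 < M.+1%:R :> R by [].
have dM0 : 0 < d / M.+1%:R by rewrite divr_gt0.
apply/stat_shift.
have qB' := (stat_shift _).2 qB.
apply: filterS2 (rt _ dM0) qB' => n rn qM Bn /eqP cn0.
have {}qM : (q n.+1)%:R <= M.+1%:R :> R by rewrite ler_nat leqW// qM.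
have c1 : 1 <= (c n.+1)%:R :> R by rewrite ler1n lt0n.
have q2 : 2 <= (q n.+1)%:R :> R by rewrite ler_nat q_gt1.
have /andP[r0 r1] := r01 n; have /andP[r'0 r'1] := r01 n.+1.
have rn' := rS n.
case: rn => [|]; first by rewrite ltr_pdivlMr// => rn; nra.
have -> : 1 - d / M.+1%:R = (M.+1%:R - d) / M.+1%:R by rewrite mulrBl divff ?lt0r_neq0.
rewrite ltr_pdivrMr// => rn.
have rq : (q n.+1)%:R - d < (c n.+1)%:R + r n.+1 by nra.
have cqn : c n.+1 = (q n.+1 - 1)%N.
  have : (q n.+1 < c n.+1 + 2)%N by rewrite -(ltr_nat R) natrD; lra.
  have := cq n; lia.
split=> //; have : (c n.+1)%:R + 1 = (q n.+1)%:R :> R.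
  by rewrite natr1 cqn subn1 prednK// ltnW.
lra.
Qed.

Lemma digit_bounded_nsupp (e : R) : 0 < e ->
  \forall n \near stat, B n -> c n = 0%N -> r n < e.
Proof.
move=> e0; pose d := Num.min e 2^-1.
have d0 : 0 < d by rewrite lt_min e0 invr_gt0 ltr0n.
have de : d <= e by rewrite ge_min lexx.
have d2 : d <= 2^-1 by rewrite ge_min lexx orbT.
have M0 : 0 < M.+1%:R :> R by rewrite ltr0n.
have dM0 : 0 < d / M.+1%:R by rewrite divr_gt0.
apply/stat_shift.
have qB' := (stat_shift _).2 qB.
apply: filterS2 (rt _ dM0) qB' => n rn qM Bn cn0.
have {}qM : (q n.+1)%:R <= M.+1%:R :> R by rewrite ler_nat leqW// qM.
have q2 : 2 <= (q n.+1)%:R :> R by rewrite ler_nat q_gt1.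
have /andP[r0 r1] := r01 n; have /andP[r'0 r'1] := r01 n.+1.
have := rS n; rewrite cn0 add0r => rn'.
case: rn => [|]; first by rewrite ltr_pdivlMr// => rn; nra.
have M1 : 1 <= M.+1%:R :> R by rewrite ler1n.
have dM : d / M.+1%:R <= 2^-1 by rewrite ler_pdivrMr//; nra.
(* A remainder near 1 is impossible: with digit 0, [2 * r n <= q n.+1 * r n = r n.+1 <= 1]. *)
move: dM; set z := d / _ => dM rn; have := ler_wpM2r r0 q2.
rewrite -rn' in r'1 *; lra.
Qed.

End Forward.

(** By the recursion the difference equals [r n / q n], which is at most [1 / q n]. *)
Lemma digit_unbounded (D : set nat) :
  (forall N, \forall n \near stat, D n -> (N <= q n)%N) ->
  forall e : R, 0 < e -> \forall n \near stat, D n ->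
   `|r n.-1 - (c n)%:R / (q n)%:R| < e.
Proof.
move=> qD e e0; apply/stat_shift.
apply: filterS ((stat_shift _).2 (qD (Num.bound e^-1).+1)) => n qN Dn /=.
have q0 : 0 < (q n.+1)%:R :> R by rewrite ltr0n ltnW.
have /andP[r'0 r'1] := r01 n.+1.
have -> : r n - (c n.+1)%:R / (q n.+1)%:R = r n.+1 / (q n.+1)%:R.
  by apply: (mulfI (lt0r_neq0 q0)); rewrite mulrBr rS; field; exact: lt0r_neq0.
rewrite ger0_norm ?divr_ge0// ltr_pdivrMr//.
apply: le_lt_trans r'1 _; rewrite -ltr_pdivrMl// mulr1.
apply: lt_le_trans (archi_boundP _) _; first by rewrite invr_ge0 ltW.
by rewrite ler_nat ltnW// qN.
Qed.

(* Each step inside the bounded part multiplies the error [r] by at most [1/2],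
   and leaving it into the unbounded part makes [r] small at once. *)
Lemma small_remainder (B E : set nat) M :
  (\forall n \near stat, B n -> (q n <= M)%N) ->
  (forall N, \forall n \near stat, ~ B n -> (N <= q n)%N) ->
  (forall e : R, 0 < e -> \forall n \near stat, E n -> (c n.+1)%:R / (q n.+1)%:R < e :> R) ->
  (forall n, E n -> B n.+1 -> c n.+1 = 0%N -> E n.+1) ->
  forall e : R, 0 < e -> \forall n \near stat, E n -> r n < e.
Proof.
move=> qB qnB cE EB.
have step (e : R) : 0 < e -> (\forall n \near stat, E n -> r n < 2 * e) ->
    \forall n \near stat, E n -> r n < e.
  move=> e0 /((stat_shift _).2) re.
  have e20 : 0 < e / 2 by rewrite divr_gt0.
  have M0 : 0 < M.+1%:R^-1 :> R by rewrite invr_gt0.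
  have qB' := (stat_shift _).2 qB.
  have qnB' := (stat_shift _).2 (qnB (Num.bound (e / 2)^-1).+1).
  (* With [q <= M], a ratio [c / q] below [1 / M.+1] forces the digit to be 0, so [EB] keeps the
     next index in [E]. *)
  have cM' := cE _ M0.
  have ce' := cE _ e20.
  near=> n => En.
  have q2 : 2 <= (q n.+1)%:R :> R by rewrite ler_nat q_gt1.
  have q0 : 0 < (q n.+1)%:R :> R by lra.
  have /andP[r0 r1] := r01 n; have /andP[r'0 r'1] := r01 n.+1.
  have rn := rS n.
  have [Bn|nBn] := pselect (B n.+1).
    have qM : (q n.+1 <= M)%N by move: Bn; near: n.
    have : (c n.+1)%:R / (q n.+1)%:R < M.+1%:R^-1 :> R.
      by move: En; near: n.
    rewrite ltr_pdivrMr// mulrC ltr_pdivlMr// -natrM ltr_nat => cM.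
    have cn0 : c n.+1 = 0%N by nia.
    have re' : r n.+1 < 2 * e by move: (EB n En Bn cn0); near: n.
    move: rn; rewrite cn0; nra.
  (* Outside [B], both [c / q] and [1 / q] are below [e / 2], and [r n <= (c + 1) / q]. *)
  have qN : ((Num.bound (e / 2)^-1).+1 <= q n.+1)%N by move: nBn; near: n.
  have : (e / 2)^-1 < (q n.+1)%:R.
    apply: lt_le_trans (archi_boundP _) _; first by rewrite invr_ge0 ltW.
    by rewrite ler_nat ltnW.
  rewrite -[ltLHS]mul1r ltr_pdivrMr// => qe.
  have : (c n.+1)%:R / (q n.+1)%:R < e / 2 by move: En; near: n.
  rewrite ltr_pdivrMr// => ce.
  nra.
(* The start is the trivial bound [r n <= 1 < 2]. A given [e] takes finitely many halvings, each
   costing one null set. *)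
have half k : \forall n \near stat, E n -> r n < 2 * 2^-1 ^+ k :> R.
  elim: k => [|k IH].
    by apply: nearW => n _; have /andP[_ r1] := r01 n; rewrite expr0; lra.
  apply: step; first by rewrite mulr_gt0 ?exprn_gt0 ?invr_gt0.
  by rewrite exprS mulVKf.
move=> e e0.
pose k := Num.bound (2 / e).
apply: filterS (half k) => n rn En; apply: lt_le_trans (rn En) _.
rewrite exprVn ler_pdivrMr ?exprn_gt0// mulrC -ler_pdivrMr// ltW//.
exact: upper_nthrootP (leqnn k).
Unshelve. all: by end_near. Qed.

End Dynamics.

(** * Consequences of the splitting property along the density-one filter *)

Section Splitting.
Context {R : realType} (q : nat -> nat) (B D : set nat).
Hypothesis hBD : d_splitting_witness R q B D.

Lemma splitting_bounded : exists M, \forall n \near stat, B n -> (q n <= M)%N.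
Proof.
case: hBD => _ _ [[->|Bpos] _] hB _; first by exists 0%N; apply: nearW.
have [B' [_ /has_density0/null_near BB' [M qM]]] := hB Bpos.
exists M; apply: filterS BB' => n nBB' Bn; apply: qM.
by apply: contrapT => nB'; apply: nBB'; left.
Qed.

Lemma splitting_divergent N : \forall n \near stat, D n -> (N <= q n)%N.
Proof.
case: hBD => _ _ [_ [->|Dpos]] _ hD; first by apply: nearW.
have [D' [_ /has_density0/null_near DD' [_ qD']]] := hD Dpos.
have /stat_le_eventually D'q : \forall n \near \oo, D' n -> (N <= q n)%N.
  exact: (qD' _ (nbhs_infty_ge N)).
apply: filterS2 DD' D'q => n nDD' h Dn; apply: h.
by apply: contrapT => nD'; apply: nDD'; left.
Qed.

Lemma splitting_cover : \forall n \near stat, B n \/ D n.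
Proof.
apply: stat_le_eventually; near=> n.
case: hBD => BD _ _ _ _; suff : (B `|` D) n by [].
by rewrite BD; near: n; exact: nbhs_infty_gt.
Unshelve. all: by end_near. Qed.

End Splitting.

(** * The characterization of topological s-torsion elements *)

Theorem theorem2p2 (R : realType) (a : nat -> nat) (ha : arithmetic_seq a)
    (x : torus R) (c : nat -> nat) (hc : canonical_repr a x c)
    (B D : set nat) (hBD : d_splitting_witness R (quot_seq a) B D) :
  s_torsion a x <->
  [/\ (* (i) *)
      [/\ almost_subset R (succ_set (suppS c B)) (supp c),
          almost_subset R (suppS c B) (supp_q a c) &
          0 < upper_density R (suppS c B) ->
          exists B1 : set nat,
            [/\ B1 `<=` B, has_density (B `\` B1) (0 : R) &
                ((c n.+1)%:R + 1) / (quot_seq a n.+1)%:R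
                  @[n --> within (suppS c B1) \oo] --> (1 : R)]],
      (* (ii) *)
      0 < upper_density R (suppN c B) ->
      exists B1 : set nat,
        [/\ B1 `<=` B, has_density (B `\` B1) (0 : R) &
            (c n.+1)%:R / (quot_seq a n.+1)%:R
              @[n --> within (suppN c B1) \oo] --> (0 : R)] &
      (* (iii) *)
      0 < upper_density R (suppS c D) ->
      exists D1 : set nat,
        [/\ D1 `<=` D, has_density (D `\` D1) (0 : R) &
            to_torus ((c n)%:R / (quot_seq a n)%:R : R)
              @[n --> within (suppS c D1) \oo] --> (0 : torus R)]].
Proof.
case: hc => cq _ xE.
set q := quot_seq a in cq hBD *.
pose r := @remainder R a c.
have q_gt1 n : (1 < q n.+1)%N by exact: quot_seq_gt1.
have cqS n : (c n.+1 < q n.+1)%N by exact: cq.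
have r01 n : 0 <= r n <= 1 by exact: remainder_itv.
have rS n : (q n.+1)%:R * r n = (c n.+1)%:R + r n.+1 by exact: remainderS.
have q0 n : 0 < (q n.+1)%:R :> R by rewrite ltr0n ltnW.
have [M qB] := splitting_bounded _ _ _ hBD.
have qD := splitting_divergent _ _ _ hBD.
have BD := splitting_cover _ _ _ hBD.
have pos : \forall n \near stat, (0 < n)%N by exact: (stat_le_eventually _ (nbhs_infty_gt 0)).
have torsion : s_torsion a x <->
    forall e : R, 0 < e -> \forall n \near stat, r n < e \/ 1 - e < r n.
  have xr n : x *+ a n = to_torus (r n) by rewrite xE to_torus_remainder.
  rewrite -torus_cvg0; last exact: nearW.
  split=> h U U0.
    have /has_density0/null_near hU := h U U0.
    apply: filterS2 pos hU => n n0 nU; apply: contrapT => nUn.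
    by apply: nU; split=> //; rewrite xr.
  apply/has_density0/null_near; apply: (@filterS _ stat _ _ _ _ (h U U0)) => n Un [_].
  by rewrite xr.
have limS := stat_cvg_realP (1 : R) B (supp c) (fun n => ((c n.+1)%:R + 1) / (q n.+1)%:R).
have limN := stat_cvg_realP (0 : R) B (pos_nats `\` supp c) (fun n => (c n.+1)%:R / (q n.+1)%:R).
have cq01 n : supp c n -> 0 <= ((c n)%:R / (q n)%:R : R) <= 1.
  case=> n0 _; have := cq n n0; move=> cqn.
  apply/andP; split; first exact: divr_ge0.
  rewrite ler_pdivrMr ?mul1r ?ler_nat ?ltr0n; first exact: ltnW.
  exact: leq_ltn_trans cqn.
have limD := stat_cvg_torusP D (supp c) (fun n => (c n)%:R / (q n)%:R) cq01.
have rD := digit_unbounded q c r q_gt1 r01 rS D qD.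
rewrite torsion; split=> [rt|[[_ Bq /limS BS] /limN BN /limD DS]].
  have rBS := digit_bounded_supp q c r q_gt1 cqS r01 rS B M qB rt.
  have rBN := digit_bounded_nsupp q c r q_gt1 r01 rS B M qB rt.
  split; [split| |].
  - apply/has_density0/null_near/stat_shift.
    (* With [r n > 1/2], a zero digit at [n.+1] would give [r n.+1 = q n.+1 * r n > 1]. *)
    have h2 : 0 < 2^-1 :> R by rewrite invr_gt0 ltr0n.
    apply: filterS (rBS _ h2) => n hn.
    case=> -[k [Bk [_ ck]] [kn]] nsupp; move: Bk ck; rewrite {k}kn => Bn cn.
    have [_ rn] := hn Bn cn; have rn' := rS n.
    have cn0 : c n.+1 = 0%N by apply: contrapT => cn0; apply: nsupp.
    have /andP[r0 _] := r01 n; have /andP[_ r'1] := r01 n.+1.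
    have q2 : 2 <= (q n.+1)%:R :> R by rewrite ler_nat q_gt1.
    have := ler_wpM2r r0 q2; rewrite rn' cn0; lra.
  - apply/has_density0/null_near; apply: filterS (rBS 1 ltr01) => n hn.
    by case=> -[Bn [n0 cn]]; apply; split=> //; have [] := hn Bn cn.
  - apply/limS => e e0; apply: filterS (rBS e e0) => n hn Bn [_ cn].
    have [_ rn] := hn Bn cn; have rn' := rS n.
    have /andP[_ r'1] := r01 n.+1.
    (* The ratio is squeezed between [r n], which exceeds [1 - e], and 1. *)
    have : r n <= ((c n.+1)%:R + 1) / (q n.+1)%:R by rewrite ler_pdivlMr//; lra.
    have : ((c n.+1)%:R + 1) / (q n.+1)%:R <= 1 :> R.
      by rewrite ler_pdivrMr// mul1r natr1 ler_nat.
    by move=> h1 h2; rewrite ger0_norm ?subr_ge0//; lra.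
  - apply/limN => e e0; apply: filterS (rBN e e0) => n hn Bn [n0 nsupp].
    have cn : c n = 0%N by apply: contrapT => cn; apply: nsupp.
    have rn := hn Bn cn; have rn' := rS n; have /andP[r'0 _] := r01 n.+1.
    rewrite sub0r normrN ger0_norm ?divr_ge0//; apply: le_lt_trans rn.
    by rewrite ler_pdivrMr//; lra.
  apply/limD => e e0; have e20 : 0 < e / 2 by rewrite divr_gt0.
  have rt' : \forall n \near stat, r n.-1 < e / 2 \/ 1 - e / 2 < r n.-1.
    by apply/stat_shift; exact: rt.
  apply: filterS2 rt' (rD _ e20) => n rn hn Dn _.
  have := hn Dn; rewrite ltr_norml => /andP[h1 h2].
  by case: rn => rn; [left|right]; lra.
have qnB N : \forall n \near stat, ~ B n -> (N <= q n)%N.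
  by apply: filterS2 BD (qD N) => n [Bn _ /(_ Bn)|Dn h _] //; exact: h.
have rBN : forall e : R, 0 < e ->
    \forall n \near stat, (B `&` (pos_nats `\` supp c)) n -> r n < e.
  apply: (small_remainder q c r q_gt1 r01 rS B _ M qB qnB).
    move=> e e0; apply: filterS (BN e e0) => n hn [Bn Nn]; have := hn Bn Nn.
    by rewrite sub0r normrN ger0_norm ?divr_ge0.
  by move=> n _ Bn cn; split=> //; split=> //; case.
have rBS : forall e : R, 0 < e ->
    \forall n \near stat, (B `&` supp c) n -> 1 - r n < e.
  have cK n : (q n.+1 - 1 - c n.+1)%:R = (q n.+1)%:R - 1 - (c n.+1)%:R :> R.
    by have h := cqS n; have q1 := q_gt1 n; rewrite natrB ?natrB //; lia.
  apply: (small_remainder q (fun n => q n - 1 - c n)%N (fun n => 1 - r n)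
    q_gt1 _ _ B _ M qB qnB).
  - by move=> n; have /andP[r0 r1] := r01 n; apply/andP; split; lra.
  - by move=> n; rewrite cK mulrBr rS; lra.
  - move=> e e0; apply: filterS (BS e e0) => n hn [Bn Sn]; have := hn Bn Sn.
    rewrite cK => /ltr_normlW; congr (_ < _).
    by field; exact: (lt0r_neq0 (q0 n)).
  (* A reflected digit 0 means [c = q - 1], which is nonzero since [q > 1]. *)
  - by move=> n _ Bn cn; split=> //; split=> //; have := q_gt1 n; have := cqS n; lia.
move/has_density0/null_near/((stat_shift _).2): Bq => Bq.
have BD' := (stat_shift _).2 BD.
move=> e e0; have e20 : 0 < e / 2 by rewrite divr_gt0.
have rBN' := (stat_shift _).2 (rBN e e0).
have rBS' := (stat_shift _).2 (rBS e e0).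
have rD' := (stat_shift _).2 (rD _ e20).
have DS' := (stat_shift _).2 (DS _ e20).
(* The position of [r n] is read off the digit at [n.+1]. On [B], [r n] is at least as close to 0
   (digit 0) or to 1 (digit [q - 1]) as [r n.+1] is; on [D], it is within [e / 2] of [c / q]. *)
near=> n.
have rn := rS n; have /andP[r0 r1] := r01 n; have /andP[r'0 r'1] := r01 n.+1.
have q1 : 1 <= (q n.+1)%:R :> R by rewrite ler1n ltnW.
have [cn0|cn0] := pselect (c n.+1 = 0%N).
  left.
  have [Bn|Dn] : B n.+1 \/ D n.+1 by near: n.
    have : r n.+1 < e.
      have : (B `&` (pos_nats `\` supp c)) n.+1 by split=> //; split=> //; case.
      by near: n.
    move: rn; rewrite cn0; nra.
  have : `|r n - (c n.+1)%:R / (q n.+1)%:R| < e / 2 by move: Dn; near: n.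
  by rewrite cn0 mul0r subr0 ltr_norml => /andP[_]; lra.
have Sn : supp c n.+1 by [].
have [Bn|Dn] : B n.+1 \/ D n.+1 by near: n.
  right.
  have r'e : 1 - r n.+1 < e by move: (conj Bn Sn); near: n.
  have Bqn : ~ (suppS c B `\` supp_q a c) n.+1 by near: n.
  have cn : c n.+1 = (q n.+1 - 1)%N.
    by apply: contrapT => cn; apply: Bqn; split=> // -[].
  have : (c n.+1)%:R + 1 = (q n.+1)%:R :> R by rewrite natr1 cn subn1 prednK// ltnW.
  nra.
have : `|r n - (c n.+1)%:R / (q n.+1)%:R| < e / 2 by move: Dn; near: n.
rewrite ltr_norml => /andP[h1 h2].
have : (c n.+1)%:R / (q n.+1)%:R < e / 2 \/ 1 - e / 2 < (c n.+1)%:R / (q n.+1)%:R :> R.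
  by move: Sn; move: Dn; near: n.
by case=> h; [left|right]; lra.
Unshelve. all: by end_near. Qed.
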